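(* Let $R$ be a commutative ring with identity $1\neq 0$ such that $|Z(R)^*|\geq 3$ and $\Gamma(R)\neq\overline{\Gamma}(R)$. If $\overline{\Gamma}(R)$ is complemented, then the total quotient ring $T(R)$ is zero-dimensional.
   Context: $Z(R)$ is the set of zero-divisors of $R$ (including $0$) and $Z(R)^*=Z(R)\setminus\{0\}$. $T(R)$ is the total quotient ring of $R$, i.e. the localization of $R$ at the multiplicative set $R\setminus Z(R)$; zero-dimensional means of Krull dimension $0$. The zero-divisor graph $\Gamma(R)$ is the simple graph with vertex set $Z(R)^*$ in which two distinct vertices $x,y$ are adjacent if and only if $xy=0$. The extended zero-divisor graph $\overline{\Gamma}(R)$ is the simple graph with the same vertex set $Z(R)^*$ in which two distinct vertices $x,y$ are adjacent if and only if there exist positive integers $n,m$ with $x^ny^m=0$, $x^n\neq 0$ and $y^m\neq 0$. In a simple graph $G$, two vertices $u,v$ are orthogonal, written $u\perp v$, if they are adjacent and no vertex is adjacent to both of them. $G$ is complemented if for every vertex $v$ there is a vertex $u$ with $v\perp u$. *)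

(* Defs.v *)
From HB Require Import structures.
From mathcomp Require Import all_boot all_order all_algebra.
From mathcomp Require Import generic_quotient ring_quotient.
From mathcomp Require Import boolp classical_sets cardinality ring.

Set Implicit Arguments.
Unset Strict Implicit.
Unset Printing Implicit Defensive.

Import GRing.Theory.
Local Open Scope ring_scope.
Local Open Scope classical_set_scope.

(** * Simple graphs *)

(* The vertex type is a parameter, so that graphs on the same vertex set can
   be compared with Leibniz equality. *)
Record sgraph (V : Type) := SGraph {
  adj : V -> V -> Prop;
  adj_sym : forall u v, adj u v -> adj v u;
  adj_irrefl : forall v, ~ adj v v }.

Definition orthogonal (V : Type) (G : sgraph V) (u v : V) : Prop :=
  adj G u v /\ ~ (exists w, adj G w u /\ adj G w v).

Definition complemented (V : Type) (G : sgraph V) : Prop :=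
  forall v, exists u, orthogonal G v u.

(** * Zero-divisors and their graphs *)

(* 0 belongs to this set, since 1 != 0 in R. *)
Definition zero_divisors (R : comNzRingType) : set R :=
  [set x | exists2 y : R, y != 0 & x * y = 0].
Arguments zero_divisors : clear implicits.

Definition zero_divisors_star (R : comNzRingType) : set R :=
  zero_divisors R `\ 0.
Arguments zero_divisors_star : clear implicits.

Section Graphs.
Variable R : comNzRingType.
Implicit Types x y : zero_divisors_star R.

Definition zd_adj x y : Prop := x <> y /\ val x * val y = 0.

Definition ext_zd_adj x y : Prop :=
  x <> y /\ exists n m : nat,
    [/\ (0 < n)%N, (0 < m)%N, val x ^+ n * val y ^+ m = 0,
        val x ^+ n != 0 & val y ^+ m != 0].

Fact zd_adj_sym x y : zd_adj x y -> zd_adj y x.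
Proof. by case=> xy e; split; [exact/nesym | rewrite mulrC]. Qed.

Fact zd_adj_irrefl x : ~ zd_adj x x.
Proof. by case. Qed.

Fact ext_zd_adj_sym x y : ext_zd_adj x y -> ext_zd_adj y x.
Proof.
case=> xy [n [m [n0 m0 e xn ym]]]; split; first exact/nesym.
by exists m, n; split; rewrite // mulrC.
Qed.

Fact ext_zd_adj_irrefl x : ~ ext_zd_adj x x.
Proof. by case. Qed.

Definition zd_graph : sgraph (zero_divisors_star R) :=
  SGraph zd_adj_sym zd_adj_irrefl.

Definition ext_zd_graph : sgraph (zero_divisors_star R) :=
  SGraph ext_zd_adj_sym ext_zd_adj_irrefl.

End Graphs.

(** * Localization of a commutative ring at a multiplicative subset *)

Section Localization.
Variables (R : comPzRingType) (S : mulrClosed R).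
Local Open Scope quotient_scope.

Definition loc_frac := (R * {s : R | s \in S})%type.
Implicit Types x y z : loc_frac.

Local Notation num x := (x.1 : R).
Local Notation den x := (sval x.2 : R).

Definition loc_mkfrac (a s : R) (Ss : s \in S) : loc_frac := (a, exist _ s Ss).

Definition loc_equivf x y : bool :=
  `[< exists2 u : R, u \in S & u * (num x * den y - num y * den x) = 0 >].

Lemma loc_equivfP x y :
  reflect (exists2 u : R, u \in S & u * (num x * den y) = u * (num y * den x))
    (loc_equivf x y).
Proof.
apply: (iffP (asboolP _)) => -[u Su e]; exists u => //.
  by apply/eqP; rewrite -subr_eq0 -mulrBr e.
by rewrite mulrBr e subrr.
Qed.

Lemma loc_equivf_refl : reflexive loc_equivf.
Proof. by move=> x; apply/loc_equivfP; exists 1; rewrite ?rpred1. Qed.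

Lemma loc_equivf_sym : symmetric loc_equivf.
Proof.
by move=> x y; apply/loc_equivfP/loc_equivfP => -[u Su e]; exists u.
Qed.

Lemma loc_equivf_trans : transitive loc_equivf.
Proof.
move=> y x z /loc_equivfP[u Su e1] /loc_equivfP[v Sv e2]; apply/loc_equivfP.
exists (u * v * den y); first by rewrite !rpredM ?(svalP y.2).
transitivity (v * den z * (u * (num x * den y))); first by ring.
rewrite e1; transitivity (u * den x * (v * (num y * den z))); first by ring.
by rewrite e2; ring.
Qed.

Canonical loc_equivf_equiv :=
  EquivRel loc_equivf loc_equivf_refl loc_equivf_sym loc_equivf_trans.

Definition localization := {eq_quot loc_equivf}.
HB.instance Definition _ : EqQuotient _ loc_equivf localization :=
  EqQuotient.on localization.
HB.instance Definition _ := Choice.on localization.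

Lemma loc_den_mul x y : den x * den y \in S.
Proof. by rewrite rpredM ?(svalP x.2) ?(svalP y.2). Qed.

Definition loc_embed (a : R) : localization :=
  \pi_localization (loc_mkfrac a (rpred1 S)).

Definition loc_addf x y : loc_frac :=
  loc_mkfrac (num x * den y + num y * den x) (loc_den_mul x y).
Definition loc_oppf x : loc_frac := (- num x, x.2).
Definition loc_mulf x y : loc_frac :=
  loc_mkfrac (num x * num y) (loc_den_mul x y).

Definition loc_add := lift_op2 localization loc_addf.
Definition loc_opp := lift_op1 localization loc_oppf.
Definition loc_mul := lift_op2 localization loc_mulf.

Lemma loc_equiv_repr x :
  exists2 u, u \in S & u * (num (repr (\pi_localization x)) * den x)
                       = u * (num x * den (repr (\pi_localization x))).
Proof. by apply/loc_equivfP/eqmodP; rewrite reprK. Qed.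

Lemma loc_pi_add : {morph \pi : x y / loc_addf x y >-> loc_add x y}.
Proof.
move=> x y; unlock loc_add; apply/esym/eqmodP/loc_equivfP => /=.
have [u Su e1] := loc_equiv_repr x; have [v Sv e2] := loc_equiv_repr y.
set x' := repr _ in e1 *; set y' := repr _ in e2 *.
exists (u * v); first by rewrite rpredM.
transitivity (v * (den y * den y') * (u * (num x' * den x))
              + u * (den x * den x') * (v * (num y' * den y))); first by ring.
by rewrite e1 e2; ring.
Qed.
Canonical loc_pi_add_morph := PiMorph2 loc_pi_add.

Lemma loc_pi_opp : {morph \pi : x / loc_oppf x >-> loc_opp x}.
Proof.
move=> x; unlock loc_opp; apply/esym/eqmodP/loc_equivfP => /=.
have [u Su e] := loc_equiv_repr x.
by exists u => //; rewrite !mulNr !mulrN e.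
Qed.
Canonical loc_pi_opp_morph := PiMorph1 loc_pi_opp.

Lemma loc_pi_mul : {morph \pi : x y / loc_mulf x y >-> loc_mul x y}.
Proof.
move=> x y; unlock loc_mul; apply/esym/eqmodP/loc_equivfP => /=.
have [u Su e1] := loc_equiv_repr x; have [v Sv e2] := loc_equiv_repr y.
exists (u * v); first by rewrite rpredM.
set x' := repr _ in e1 *; set y' := repr _ in e2 *.
transitivity ((u * (num x' * den x)) * (v * (num y' * den y))); first by ring.
by rewrite e1 e2; ring.
Qed.
Canonical loc_pi_mul_morph := PiMorph2 loc_pi_mul.

Lemma loc_frac_eq x y : num x = num y -> den x = den y -> x = y.
Proof. by case: x y => [a s] [b t] /= -> /val_inj ->. Qed.

Lemma loc_addA : associative loc_add.
Proof.
elim/quotW=> x; elim/quotW=> y; elim/quotW=> z; rewrite !piE.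
congr (\pi _); apply: loc_frac_eq => /=; last by rewrite mulrA.
by rewrite !mulrDl !mulrA addrA; congr (_ + _ + _); rewrite mulrAC.
Qed.

Lemma loc_addC : commutative loc_add.
Proof.
elim/quotW=> x; elim/quotW=> y; rewrite !piE.
by congr (\pi _); apply: loc_frac_eq => /=; rewrite 1?addrC 1?mulrC.
Qed.

Lemma loc_add0 : left_id (loc_embed 0) loc_add.
Proof.
elim/quotW=> x; rewrite /loc_embed !piE.
by congr (\pi _); apply: loc_frac_eq => /=; rewrite ?mul0r ?mulr1 ?add0r ?mul1r.
Qed.

Lemma loc_addN : left_inverse (loc_embed 0) loc_opp loc_add.
Proof.
elim/quotW=> x; rewrite /loc_embed !piE; apply/eqmodP/loc_equivfP.
by exists 1; rewrite ?rpred1 //= mulNr addNr !mul0r.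
Qed.

HB.instance Definition _ :=
  GRing.isZmodule.Build localization
    loc_addA loc_addC loc_add0 loc_addN.

Lemma loc_mulA : associative loc_mul.
Proof.
elim/quotW=> x; elim/quotW=> y; elim/quotW=> z; rewrite !piE.
by congr (\pi _); apply: loc_frac_eq => /=; rewrite mulrA.
Qed.

Lemma loc_mulC : commutative loc_mul.
Proof.
elim/quotW=> x; elim/quotW=> y; rewrite !piE.
by congr (\pi _); apply: loc_frac_eq => /=; rewrite mulrC.
Qed.

Lemma loc_mul1 : left_id (loc_embed 1) loc_mul.
Proof.
elim/quotW=> x; rewrite /loc_embed !piE.
by congr (\pi _); apply: loc_frac_eq => /=; rewrite mul1r.
Qed.

Lemma loc_mulDl : left_distributive loc_mul loc_add.
Proof.
elim/quotW=> x; elim/quotW=> y; elim/quotW=> z; rewrite !piE.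
by apply/eqmodP/loc_equivfP; exists 1; rewrite ?rpred1 //=; ring.
Qed.

HB.instance Definition _ :=
  GRing.Zmodule_isComPzRing.Build localization
    loc_mulA loc_mulC loc_mul1 loc_mulDl.

End Localization.

(** * Total quotient ring *)

Definition regular (R : comNzRingType) : {pred R} :=
  [pred x | x \notin zero_divisors R].
Arguments regular : clear implicits.

Section TotalQuotient.
Variable R : comNzRingType.

Lemma regularP (x : R) :
  reflect (forall y, x * y = 0 -> y = 0) (x \in regular R).
Proof.
rewrite unfold_in /=; apply: (iffP idP); rewrite notin_setE.
  move=> xr y xy; apply: contra_notP xr => /eqP y0.
  by exists y.
move=> xr [y y0 /xr y0'].
by rewrite y0' eqxx in y0.
Qed.

Fact regular_mulr_closed : mulr_closed (regular R).
Proof.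
split=> [|x y /regularP xr /regularP yr]; apply/regularP => z.
  by rewrite mul1r.
by rewrite -mulrA => /xr /yr.
Qed.

HB.instance Definition _ :=
  GRing.isMulClosed.Build R (regular R) regular_mulr_closed.

Definition total_quotient := localization (regular R).

HB.instance Definition _ := GRing.ComPzRing.on total_quotient.

Fact total_quotient_nonzero : 1 != 0 :> total_quotient.
Proof.
apply/eqP => /eqmodP /loc_equivfP [u /regularP ur] /=.
by rewrite mul1r mul0r mulr0 => /ur /eqP; rewrite oner_eq0.
Qed.

HB.instance Definition _ :=
  GRing.PzSemiRing_isNonZero.Build total_quotient total_quotient_nonzero.

End TotalQuotient.
Arguments total_quotient : clear implicits.

(** * Krull dimension *)

(* A chain P_0 < P_1 < ... < P_n of n.+1 prime ideals has length n. *)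
Definition prime_chain (A : comNzRingType) (n : nat)
    (P : 'I_n.+1 -> prime_idealr A) : Prop :=
  forall i j : 'I_n.+1, (i < j)%N ->
    {subset P i <= P j} /\ ~ {subset P j <= P i}.

(* The supremum of the lengths of chains of prime ideals is d. *)
Definition has_krull_dim (A : comNzRingType) (d : nat) : Prop :=
  (exists P : 'I_d.+1 -> prime_idealr A, prime_chain P) /\
  (forall n (P : 'I_n.+1 -> prime_idealr A), prime_chain P -> (n <= d)%N).

Definition zero_dimensional (A : comNzRingType) : Prop := has_krull_dim A 0.

(* Main.v *)
(* Call x power-regular if x^n v = 0 and x^n + v is regular for some n > 0 and
   some v; if every x is, then in T(R) no prime contains another properly.
   A non-nilpotent zero-divisor x with a non-nilpotent complement is
   power-regular.  If x is not, then its complement u is nilpotent, and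
   orthogonality forces u^2 = 0, Ru = {0, u} and ann(x^j) = {0, u} for j > 0.
   Every zero-divisor y then kills u: otherwise yb = 0 with b <> 0, the only
   possible complement of xy is u, and b is adjacent to both.  So u is adjacent
   to every other vertex and is the complement of each of them; hence two
   vertices a, b <> u are never adjacent in the extended graph, as b would be
   adjacent to both a and u.  The two graphs thus coincide. *)

Require Import Defs.
From mathcomp Require Import all_boot all_algebra.
From mathcomp Require Import classical_sets cardinality.
From HB Require Import structures.
From mathcomp Require Import generic_quotient ring_quotient boolp ring.

Set Implicit Arguments.
Unset Strict Implicit.
Unset Printing Implicit Defensive.

Import GRing.Theory.
Local Open Scope ring_scope.

Local Open Scope classical_set_scope.
Local Open Scope card_scope.

(** * Existence of a prime ideal, by Zorn's lemma *)

Lemma prime_idealr_exists (A : comNzRingType) : inhabited (prime_idealr A).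
Proof.
(* 0 is not required to belong to X, so that the empty chain has an upper
   bound. *)
pose lin_proper (X : set A) :=
  (forall a u v, X u -> X v -> X (a * u + v)) /\ ~ X 1.
have [F Flin totF|M [[Mlin M1] Mmax]] := @Zorn_bigcup A lin_proper.
  split=> [a u v [X FX Xu] [Y FY Yv]|[X FX X1]]; last first.
    by case: (Flin _ FX) => _; apply.
  have [XY|YX] := totF _ _ FX FY.
    by exists Y => //; case: (Flin _ FY) => linY _; apply: linY; [exact: XY|].
  by exists X => //; case: (Flin _ FX) => linX _; apply: linX; last exact: YX.
have M0 : M 0.
  have [[m Mm]|Mempty] := pselect (exists m, M m).
    by rewrite -(addNr m) -mulN1r; apply: Mlin.
  case: (Mmax [set 0]); last split=> [a u v -> ->|/eqP].
  - split=> [m Mm|]; first by case: Mempty; exists m.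
    by move=> /(_ 0 erefl) M0; apply: Mempty; exists 0.
  - by rewrite mulr0 addr0.
  - by rewrite oner_eq0.
have Mprime u v : M (u * v) -> M u \/ M v.
  move=> Muv; apply: contrapT => /not_orP[Mu Mv].
  (* The ideal [M + Au]: were 1 in it, multiplying by [v] would put [v] in [M]. *)
  pose B := [set t | exists r, exists2 m, M m & t = r * u + m].
  case: (Mmax B).
    split=> [m Mm|BM].
      by exists 0, m => //; rewrite mul0r add0r.
    by apply: Mu; apply: BM; exists 1, 0 => //; rewrite mul1r addr0.
  split=> [a _ _ [r [m Mm ->]] [s [k Mk ->]]|[r [m Mm e]]].
    by exists (a * r + s), (a * m + k); [exact: Mlin|ring].
  apply: Mv; rewrite -(mul1r v) e.
  suff -> : (r * u + m) * v = r * (u * v) + (v * m + 0).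
    by apply: (Mlin) => //; apply: Mlin.
  by ring.
pose S : A -> bool := fun x => `[< M x >].
have SP x : reflect (M x) (x \in S) by apply: asboolP.
have Sideal : idealr_closed S.
  split; [exact/SP|exact/SP|] => a u v /SP Mu /SP Mv.
  by apply/SP; apply: Mlin.
have Sprime : prime_idealr_closed S.
  move=> u v /SP /Mprime[Mu|Mv]; apply/orP; [left|right]; exact/SP.
pose I1 := isIdealr.Build A S Sideal.
pose I2 := isPrimeIdealrClosed.Build A S Sprime.
by constructor; pose P := HB.pack_for (prime_idealr A) S I1 I2; exact: P.
Qed.

(** * Zero-dimensionality of the total quotient ring *)

Section TotalQuotientDimension.
Variable R : comNzRingType.
Local Open Scope quotient_scope.

(* Retyping [loc_embed] so that the ideals of [total_quotient R] apply to its
   values. *)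
Definition embed (a : R) : total_quotient R := loc_embed (regular R) a.

Definition power_regular (x : R) : Prop :=
  exists n v, [/\ (0 < n)%N, x ^+ n * v = 0 & x ^+ n + v \in regular R].

Lemma embedD (a b : R) : embed (a + b) = embed a + embed b.
Proof.
rewrite /embed /loc_embed [RHS]piE; apply/eqmodP/loc_equivfP.
by exists 1; rewrite ?rpred1 //=; ring.
Qed.

Lemma embedM (a b : R) : embed (a * b) = embed a * embed b.
Proof.
rewrite /embed /loc_embed [RHS]piE; apply/eqmodP/loc_equivfP.
by exists 1; rewrite ?rpred1 //=; ring.
Qed.

Lemma embed0 : embed 0 = 0. Proof. by []. Qed.

Lemma embed1 : embed 1 = 1. Proof. by []. Qed.

Lemma embedX (a : R) n : embed (a ^+ n) = embed a ^+ n.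
Proof. by elim: n => [|n IHn]; rewrite ?embed1 // !exprS embedM IHn. Qed.

Lemma embed_regular (r : R) (rr : r \in regular R) :
  exists t : total_quotient R, embed r * t = 1.
Proof.
exists (\pi_(localization (regular R)) (loc_mkfrac 1 rr)).
rewrite -embed1 /embed /loc_embed [LHS]piE; apply/eqmodP/loc_equivfP.
by exists 1; rewrite ?rpred1 //=; ring.
Qed.

Lemma total_quotientP (t : total_quotient R) :
  exists a s, s \in regular R /\ t * embed s = embed a.
Proof.
elim/quotW: t => -[a [s sr]]; exists a, s; split=> //.
rewrite /embed /loc_embed [LHS]piE; apply/eqmodP/loc_equivfP.
by exists 1; rewrite ?rpred1 //=; ring.
Qed.

(** Take [t] in the larger of two nested primes and clear its denominator to get [a]. If [a] is
    outside the smaller prime, then [a ^+ k * v = 0] puts [v] in it, so the larger prime contains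
    [a ^+ k + v], a unit of the total quotient ring. *)
Lemma zero_dimensional_total_quotient :
  (forall x, power_regular x) -> zero_dimensional (total_quotient R).
Proof.
move=> pregR; split.
  have [P] := prime_idealr_exists (total_quotient R).
  by exists (fun=> P) => i j; rewrite !ord1.
case=> // n P /(_ ord0 ord_max isT)[sub]; case=> t tPn.
have [a [s [sr ets]]] := total_quotientP t.
have [s' es'] := embed_regular sr.
have [k [v [k0 akv akvr]]] := pregR a.
have [r er] := embed_regular akvr.
have aPn : embed a \in P ord_max by rewrite -ets mulrC idealMr.
have [aP0|aP0] := boolP (embed a \in P ord0).
  by rewrite -[t]mulr1 -es' mulrA ets mulrC idealMr.
have vP0 : embed v \in P ord0.
  have : embed (a ^+ k) * embed v \in P ord0.
    by rewrite -embedM akv embed0 rpred0.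
  rewrite prime_idealrM => /orP[|//]; rewrite embedX.
  elim: k {k0 akv akvr er} => [|k IHk]; first by rewrite expr0 idealr1.
  by rewrite exprS prime_idealrM (negbTE aP0) /= => /IHk.
case/negP: (negbT (idealr1 (P ord_max))); rewrite -er mulrC; apply: idealMr.
rewrite embedD rpredD //.
  by rewrite embedX -(prednK k0) exprSr idealMr.
exact: sub.
Qed.

End TotalQuotientDimension.

(** * Complements in the extended graph *)

Section ExtendedGraph.
Variable R : comNzRingType.
Implicit Types a b c u w x y : R.

(** Stated on ring elements: vertex membership follows from adjacency, by
    [ext_adj_zero_divisors_star]. *)
Definition ext_adj a b : Prop :=
  a <> b /\ exists n m : nat,
    [/\ (0 < n)%N, (0 < m)%N, a ^+ n * b ^+ m = 0, a ^+ n != 0 & b ^+ m != 0].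

Definition complement a u : Prop :=
  ext_adj a u /\ forall w, ext_adj w a -> ext_adj w u -> False.

Definition non_nilpotent a : Prop := forall n, a ^+ n != 0.

Lemma ext_adj_sym a b : ext_adj a b -> ext_adj b a.
Proof.
case=> ab [n [m [n0 m0 e an bm]]]; split; first exact/nesym.
by exists m, n; split; rewrite // mulrC.
Qed.

Lemma zero_divisors_starP a b :
  a != 0 -> b != 0 -> a * b = 0 -> zero_divisors_star R a.
Proof. by move=> a0 b0 ab; split; [exists b | apply/eqP]. Qed.

Lemma ext_adj_zero_divisors_star a b : ext_adj a b -> zero_divisors_star R a.
Proof.
case=> _ [n [m [n0 m0 ab an bm]]]; split.
  apply: contrapT => anz; have ar : a \in regular R.
    by rewrite unfold_in /= notin_setE.
  by move/regularP: (rpredX n ar) => /(_ _ ab) /eqP; apply/negP.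
by move=> /= a0; rewrite a0 expr0n eqn0Ngt n0 eqxx in an.
Qed.

Lemma complement_exists a : complemented (ext_zd_graph R) ->
  zero_divisors_star R a -> exists u, complement a u.
Proof.
move=> hcompl /mem_set az; have [u [[au auP] umax]] := hcompl (SigSub az).
exists (val u); split; first by split=> // e; apply: au; exact: val_inj.
move=> w wa wu; apply: umax.
exists (SigSub (mem_set (ext_adj_zero_divisors_star wa))).
split; first by case: wa => wa waP; split=> // -[].
by case: wu => wu wuP; split=> // e; apply: wu; rewrite -e.
Qed.

(** The working form of orthogonality: [w], to the first power, would be adjacent to both [a] and
    [u]. The exponents [i] and [j] are positive because [w != 0]. *)
Lemma complementP a u w i j : complement a u ->
  w != 0 -> w <> a -> w <> u -> a ^+ i != 0 -> u ^+ j != 0 ->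
  w * a ^+ i = 0 -> w * u ^+ j = 0 -> False.
Proof.
case=> _ cau w0 wa wu ai uj wai wuj.
have pos k c : w * c ^+ k = 0 -> (0 < k)%N.
  by case: k => // /eqP; rewrite mulr1 (negbTE w0).
by apply: (cau w); split=> //; exists 1%N; [exists i | exists j];
  split=> //; apply: pos; eassumption.
Qed.

(** For [k] with [x ^+ k * u ^+ k = 0], anything that kills [x ^+ k + u ^+ k] kills [x ^+ (k + k)]
    and [u ^+ (k + k)]; if nonzero, it would be a common neighbour of [x] and [u]. *)
Lemma complement_power_regular x u :
  complement x u -> non_nilpotent x -> non_nilpotent u -> power_regular x.
Proof.
move=> cxu xn un; have [[_ [n [m [n0 _ e _ _]]]] _] := cxu.
exists (n + m)%N, (u ^+ (n + m)).
have xu0 : x ^+ (n + m) * u ^+ (n + m) = 0.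
  transitivity (x ^+ n * u ^+ m * (x ^+ m * u ^+ n)).
    by rewrite !exprD; ring.
  by rewrite e mul0r.
split=> //; first by rewrite addn_gt0 n0.
apply/regularP => w sw; apply/eqP; apply: contraT => w0; exfalso.
set k := (n + m)%N in xu0 sw.
have wx : w * x ^+ (k + k) = 0.
  transitivity (x ^+ k * ((x ^+ k + u ^+ k) * w) - w * (x ^+ k * u ^+ k)).
    by rewrite exprD; ring.
  by rewrite sw xu0 !mulr0 subr0.
have wu : w * u ^+ (k + k) = 0.
  transitivity (u ^+ k * ((x ^+ k + u ^+ k) * w) - w * (x ^+ k * u ^+ k)).
    by rewrite exprD; ring.
  by rewrite sw xu0 !mulr0 subr0.
apply: (complementP cxu w0 _ _ (xn _) (un _) wx wu) => e'.
  by move/eqP: wx; rewrite e' -exprS (negbTE (xn _)).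
by move/eqP: wu; rewrite e' -exprS (negbTE (un _)).
Qed.

(** A nonzero nilpotent element killing [u] and some [x ^+ n] must be [u], or it would be a common
    neighbour. This is applied to the last nonzero power of [u], then to the multiples [r * u]. *)
Lemma nilpotent_complement x u : complement x u -> non_nilpotent x ->
  ~ non_nilpotent u ->
  [/\ u != 0, u * u = 0, x * u = 0 & forall r, r * u = 0 \/ r * u = u].
Proof.
move=> cxu xn /existsNP[n0 /negP/negPn un0].
have [[_ [n [m [npos mpos e xn0 um]]]] _] := cxu.
have u0 : u != 0 by apply: contraNneq um => ->; rewrite expr0n eqn0Ngt mpos.
have nnx w k : w ^+ k.+1 = 0 -> w <> x.
  by move=> /eqP + e'; rewrite e' (negbTE (xn _)).
have exk : exists k, u ^+ k == 0 by exists n0.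
have [k /eqP uk kmin] := ex_minnP exk.
have mk : (m < k)%N.
  rewrite ltnNge; apply: contra um => km.
  by rewrite -(subnK km) exprD uk mulr0.
case: k uk kmin mk => // k uk kmin mk.
have ukn0 : u ^+ k != 0 by apply/negP => /kmin; rewrite ltnn.
have wx0 : u ^+ k * x ^+ n = 0.
  by rewrite mulrC -(subnKC (mk : (m <= k)%N)) exprD mulrA e mul0r.
have k1 : k = 1%N.
  case: k uk kmin mk ukn0 wx0 => [|[//|k]] uk kmin mk ukn0 wx0.
    by move: mk mpos; case: m {e um}.
  exfalso; apply: (@complementP x u (u ^+ k.+2) n 1 cxu) => //.
  - by apply: (nnx _ k.+2); rewrite -exprM mulnC mulnS exprD uk mul0r.
  - move=> eu; have uu : u * u = 0 by rewrite -{1}eu -exprSr.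
    by rewrite !exprS mulrA uu mul0r eqxx in ukn0.
  - by rewrite -exprSr.
subst k; have uu : u * u = 0 by [].
rewrite expr1 in wx0.
have Ru r : r * u = 0 \/ r * u = u.
  have [->|ru] := eqVneq (r * u) 0; [by left | right].
  apply: contrapT => ruu; apply: (@complementP x u (r * u) n 1 cxu) => //.
  - by apply: (nnx _ 1%N); rewrite expr2 mulrACA uu mulr0.
  - by rewrite -mulrA wx0 mulr0.
  - by rewrite expr1 -mulrA uu mulr0.
(* If [x * u = u], then [x ^+ n] fixes [u], against [wx0]. *)
split=> //; case: (Ru x) => // xu; move/eqP: u0; case.
rewrite -wx0 mulrC; elim: n {npos e xn0 wx0} => [|n IHn].
  by rewrite mul1r.
by rewrite exprSr -mulrA xu.
Qed.

(** * Consequences of a nilpotent complement *)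

Section NilpotentComplement.
Variables x u : R.
Hypotheses (hcompl : complemented (ext_zd_graph R)) (cxu : complement x u)
  (xn : non_nilpotent x) (xnpr : ~ power_regular x).
Hypotheses (u0 : u != 0) (uu : u * u = 0) (xu : x * u = 0)
  (Ru : forall r, r * u = 0 \/ r * u = u).

Lemma non_nilpotent_neq_u a : non_nilpotent a -> u <> a.
Proof. by move=> /(_ 2) + ua; rewrite -ua expr2 uu eqxx. Qed.

Lemma exprX_fix r j : r * u = u -> r ^+ j * u = u.
Proof.
by move=> ru; elim: j => [|j IHj]; rewrite ?mul1r // exprSr -mulrA ru.
Qed.

(** If [w * u = 0], then [w] is a common neighbour of [x] and [u] unless it is 0 or [u]. If
    [w * u = u], then [x ^+ j + w] is regular, against [xnpr]. *)
Lemma annihilator_expX w j : w * x ^+ j = 0 -> w = 0 \/ w = u.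
Proof.
move=> wx; have [->|w0] := eqVneq w 0; [by left | right].
apply: contrapT => wu.
have nx v i : v * x ^+ i = 0 -> v != 0 -> v <> x.
  by move=> /eqP + _ e; rewrite e -exprS (negbTE (xn _)).
have kill v i : v * u = 0 -> v * x ^+ i = 0 -> v != 0 -> v = u.
  move=> vu vx v0; apply: contrapT => vnu.
  apply: (@complementP x u v i 1 cxu) => //; first exact: nx vx v0.
have [/kill/(_ wx w0)//|wuu] := Ru w.
have jpos : (0 < j)%N.
  by case: j wx => // /eqP; rewrite mulr1 (negbTE w0).
apply: xnpr; exists j, w; split; rewrite 1?mulrC //.
apply/regularP => t tr; apply/eqP; apply: contraT => t0; exfalso.
have tx : t * x ^+ (j + j) = 0.
  transitivity (x ^+ j * ((x ^+ j + w) * t) - t * (w * x ^+ j)).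
    by rewrite exprD; ring.
  by rewrite tr wx !mulr0 subr0.
have tw : t * w ^+ 2 = 0.
  transitivity (w * ((x ^+ j + w) * t) - t * (w * x ^+ j)); first by ring.
  by rewrite tr wx !mulr0 subr0.
have wu2 := exprX_fix 2 wuu.
(* If [t * u = 0], then [t = u], so [w ^+ 2] both kills and fixes [u]. Otherwise [t * w ^+ 2 = 0]
   fixes [u]. *)
have [tu|tu] := Ru t.
  by move/eqP: u0; apply; rewrite -wu2 -(kill t _ tu tx t0) mulrC.
by move/eqP: u0; apply; rewrite -tu -wu2 mulrA tw mul0r.
Qed.

Lemma zero_divisor_kills_u y : zero_divisors R y -> y * u = 0.
Proof.
case=> b b0 yb; have [//|yu] := Ru y; exfalso.
have bu : b * u = 0 by rewrite -yu mulrA [b * y]mulrC yb mul0r.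
have b_neq_u : u <> b by move=> e; move: u0; rewrite -yu e yb eqxx.
(* Otherwise some [y ^+ j] is 0 or [u] and kills [u], although it fixes [u]. *)
have xyn : non_nilpotent (x * y).
  move=> j; apply/eqP; rewrite exprMn mulrC => /annihilator_expX yj.
  move: u0; rewrite -(exprX_fix j yu).
  by case: yj => ->; rewrite ?mul0r ?uu eqxx.
have xyu : x * y * u = 0 by rewrite -mulrA yu.
have [w cxyw] : exists w, complement (x * y) w.
  apply: complement_exists => //; apply: (zero_divisors_starP (b := u)) => //.
  by rewrite -[x * y]expr1.
(* Suppose [w] is not nilpotent. If [w * u = 0], then [u] is a common neighbour of [x * y] and [w];
   if not, [w ^+ m * y ^+ n] kills [x ^+ n], so it is 0 or [u], yet it fixes [u]. *)
have wn : ~ non_nilpotent w.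
  move=> wn; have [wu|wu] := Ru w.
    apply: (@complementP _ _ u 1 1 cxyw) => //; try exact: non_nilpotent_neq_u.
      by rewrite mulrC.
    by rewrite mulrC.
  have [[_ [n [m [_ _ e _ _]]]] _] := cxyw.
  have : w ^+ m * y ^+ n * x ^+ n = 0 by rewrite -e exprMn; ring.
  have : w ^+ m * y ^+ n * u = u by rewrite -mulrA !exprX_fix.
  move=> eu /annihilator_expX.
  by case=> ewy; move: u0; rewrite -eu ewy ?mul0r ?uu eqxx.
have [w0 ww _ Rw] := nilpotent_complement cxyw xyn wn.
have w1 : w ^+ 1 != 0 by [].
(* If they differ, [u * w] lies in [{0, w}] and in [{0, u}], hence is 0, and [u] is a common
   neighbour of [x * y] and [w]. *)
have wu : u = w.
  apply: contrapT => nuw.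
  apply: (@complementP _ _ u 1 1 cxyw) => //; first exact: non_nilpotent_neq_u.
    by rewrite mulrC.
  have [//|uw] := Rw u; have [|wu'] := Ru w; first by rewrite mulrC.
  by case: nuw; rewrite -wu' mulrC.
rewrite -wu in cxyw.
have b_neq_xy : b <> x * y.
  move=> e; have /eqP := xyn 2; apply.
  by rewrite expr2 -[X in _ * X]e -mulrA yb mulr0.
apply: (@complementP _ _ b 1 1 cxyw) => //; first exact/nesym.
by rewrite expr1 mulrCA [b * y]mulrC yb mulr0.
Qed.

Lemma ext_adj_mul0 a b : ext_adj a b -> a * b = 0.
Proof.
move=> ab.
have [anz a0] := ext_adj_zero_divisors_star ab.
have [bnz b0] := ext_adj_zero_divisors_star (ext_adj_sym ab).
have [->|au] := eqVneq a u; first by rewrite mulrC zero_divisor_kills_u.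
have [->|bu] := eqVneq b u; first by rewrite zero_divisor_kills_u.
exfalso; have [v cav] := complement_exists hcompl (conj anz a0).
have [[_ [n [m [npos mpos e an vm]]]] _] := cav.
have [vnz _] := ext_adj_zero_divisors_star (ext_adj_sym cav.1).
(* If [v = u], the vertex [b] is adjacent to both [a] and [u]; if not, [u] is adjacent to both [a]
   and [v]. *)
have [vu|vu] := eqVneq u v.
  rewrite -vu in cav; case: cav => _ /(_ b (ext_adj_sym ab)); apply.
  split; first exact/eqP.
  case: ab => _ [i [j [_ jpos _ _ bj]]]; exists j, 1%N; split=> //.
  by rewrite -(prednK jpos) exprSr -mulrA zero_divisor_kills_u ?mulr0.
apply: (@complementP _ _ u n m cav) => //; try exact/eqP; try exact/nesym/eqP.
- by rewrite -(prednK npos) exprS mulrA [u * a]mulrC zero_divisor_kills_u ?mul0r.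
- by rewrite -(prednK mpos) exprS mulrA [u * v]mulrC zero_divisor_kills_u ?mul0r.
Qed.

End NilpotentComplement.

End ExtendedGraph.

(** * Equality of graphs and the conclusion *)

Lemma sgraph_ext (V : Type) (G H : sgraph V) :
  (forall a b, adj G a b <-> adj H a b) -> G = H.
Proof.
case: G H => [e es ei] [f fs fi] /= ef.
have {}ef : e = f by apply/funext => a; apply/funext => b; apply/propext.
by subst f; congr SGraph; apply: Prop_irrelevance.
Qed.

Theorem theorem4p2 (R : comNzRingType)
    (hcard : `I_3 #<= zero_divisors_star R)
    (hne : zd_graph R <> ext_zd_graph R)
    (hcompl : complemented (ext_zd_graph R)) :
  zero_dimensional (total_quotient R).
Proof.
apply: zero_dimensional_total_quotient => x; apply: contrapT => xnpr.
(* A nilpotent element is power-regular with [v = 1]; [n.+1] keeps the exponent positive. *)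
have xn : non_nilpotent x.
  move=> n; apply/negP => /eqP xn0; apply: xnpr; exists n.+1, 1.
  split; first by [].
    by rewrite mulr1 exprS xn0 mulr0.
  by rewrite exprS xn0 mulr0 add0r rpred1.
have xz : zero_divisors_star R x.
  split; last by apply/eqP; rewrite -[x]expr1.
  (* A regular element is power-regular with [v = 0]. *)
  apply: contrapT => xz; apply: xnpr; exists 1%N, 0; split=> //.
    by rewrite mulr0.
  by rewrite addr0 expr1 unfold_in /= notin_setE.
have [u cxu] := complement_exists hcompl xz.
have un : ~ non_nilpotent u.
  by move=> un; apply: xnpr; exact: complement_power_regular cxu xn un.
have [u0 uu xu Ru] := nilpotent_complement cxu xn un.
apply: hne; apply: sgraph_ext => a b; split=> -[ab].
  move=> e; split=> //; exists 1%N, 1%N; split=> //.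
    by have /set_mem[_ /eqP] := valP a.
  by have /set_mem[_ /eqP] := valP b.
move=> abP; split=> //.
apply: (ext_adj_mul0 hcompl cxu xn xnpr u0 uu xu Ru); split=> // e.
by apply: ab; exact: val_inj.
Qed.
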